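(* Let $K$ be a complete discrete valuation field with ring of integers $\mathcal{O}_K$ and uniformizer $\pi$. Suppose that $M \in \mathrm{GL}_n(\mathcal{O}_K)$ is known with precision $O(\pi^m)$. Then the precision lattice of the characteristic polynomial of $M$, namely $d\chi_M\big(\pi^m M_n(\mathcal{O}_K)\big)$, is strictly contained in $O(\pi^m) = \pi^m\big(\mathcal{O}_K[X] \cap K_{<n}[X]\big)$ if and only if the reduction of $M$ modulo $\pi$ does not have a cyclic vector.
   Context: $\chi$ is the characteristic polynomial map $M \mapsto \chi_M = \det(XI_n - M)$ from $M_n(K)$ to monic polynomials of degree $n$, and $d\chi_M : M_n(K) \to K_{<n}[X]$ is its differential at $M$, a $K$-linear map to the space $K_{<n}[X]$ of polynomials of degree less than $n$; up to sign, $d\chi_M(dM) = \mathrm{Tr}(\mathrm{Com}(XI_n-M)\cdot dM)$, where $\mathrm{Com}$ denotes the comatrix (adjugate, $A\cdot\mathrm{Com}(A) = \det(A)I_n$). Knowing $M$ with (flat) precision $O(\pi^m)$ means that the entries of $M$ are known modulo $\pi^m\mathcal{O}_K$, i.e. the precision lattice on $M$ is $\pi^m M_n(\mathcal{O}_K)$; the resulting precision lattice on $\chi_M$ is the image of this lattice under $d\chi_M$. A matrix $\bar M \in M_n(k)$ over a field $k$ has a cyclic vector if there is $c \in k^n$ such that $c, \bar Mc, \ldots, \bar M^{n-1}c$ is a basis of $k^n$; here $k = \mathcal{O}_K/\pi\mathcal{O}_K$. *)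

(* Defs.v *)
From HB Require Import structures.
From mathcomp Require Import all_boot all_order all_algebra.
From mathcomp Require Import boolp classical_sets.

Set Implicit Arguments.
Unset Strict Implicit.
Unset Printing Implicit Defensive.

Import Order.TTheory GRing.Theory Num.Theory.
Local Open Scope ring_scope.
Local Open Scope quotient_scope.
Local Open Scope classical_set_scope.

(* A normalized discrete valuation.  The value [dval 0] is unconstrained and
   plays no role: v(0) = +oo is rendered by [vge] below. *)
Record discrete_valuation (K : fieldType) := DiscreteValuation {
  dval :> K -> int;
  dvalM : forall x y, x != 0 -> y != 0 -> dval (x * y) = dval x + dval y;
  dvalD : forall x y, x != 0 -> y != 0 -> x + y != 0 ->
    Num.min (dval x) (dval y) <= dval (x + y);
  dval_surj : forall z : int, exists2 x, x != 0 & dval x = z }.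

Section Valuation.
Context (K : fieldType) (v : discrete_valuation K).

(* v(x) >= N, with v(0) = +oo *)
Definition vge (N : int) : {pred K} := fun x => (x == 0) || (N <= v x).

Definition cauchy_seq (u : nat -> K) := forall N : int,
  exists n0 : nat, forall i j, (n0 <= i)%N -> (n0 <= j)%N -> vge N (u i - u j).

Definition converges_to (u : nat -> K) (l : K) := forall N : int,
  exists n0 : nat, forall i, (n0 <= i)%N -> vge N (u i - l).

Definition complete := forall u, cauchy_seq u -> exists l, converges_to u l.

Definition integers : {pred K} := vge 0.

Lemma dval1 : v 1 = 0.
Proof.
have := @dvalM _ v 1 1 (oner_neq0 K) (oner_neq0 K).
by rewrite mulr1 -{1}[v 1]addr0 => /addrI.
Qed.

Lemma dvalV x : x != 0 -> v x^-1 = - v x.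
Proof.
move=> x0; apply/eqP; rewrite -addr_eq0 -dvalM ?invr_eq0 //.
by rewrite mulVf // dval1.
Qed.

Lemma dvalN x : v (- x) = v x.
Proof.
have n1 : -1 != 0 :> K by rewrite oppr_eq0 oner_neq0.
have vn1 : v (-1) = 0.
  have := @dvalM _ v (-1) (-1) n1 n1.
  rewrite mulrNN mulr1 dval1 => /esym/eqP.
  by rewrite -mulr2n mulrn_eq0 /= => /eqP.
have [->|x0] := eqVneq x 0; first by rewrite oppr0.
by rewrite -mulN1r dvalM // vn1 add0r.
Qed.

Lemma vgeB N x y : vge N x -> vge N y -> vge N (x - y).
Proof.
rewrite /vge; have [->|x0] := eqVneq x 0.
  by rewrite sub0r oppr_eq0 dvalN.
have [->|y0] := eqVneq y 0; first by rewrite subr0 (negPf x0).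
move=> /= vx vy; case: eqVneq => //= xy0.
have ny0 : - y != 0 by rewrite oppr_eq0.
apply: le_trans (dvalD v x0 ny0 xy0).
by rewrite dvalN le_min vx vy.
Qed.

Fact integers_subring_closed : subring_closed integers.
Proof.
split; first by rewrite unfold_in /vge dval1 lexx orbT.
  by move=> x y; exact: vgeB.
move=> x y; rewrite !unfold_in /vge mulf_eq0.
case: eqVneq => //= x0; case: eqVneq => //= y0 vx vy.
by rewrite dvalM // addr_ge0.
Qed.

HB.instance Definition _ :=
  GRing.isSubringClosed.Build K integers integers_subring_closed.

Record valring : predArgType := Valring {
  valring_val : K;
  _ : valring_val \in integers }.

HB.instance Definition _ := [isSub for valring_val].
HB.instance Definition _ := [Choice of valring by <:].
HB.instance Definition _ := [SubChoice_isSubComNzRing of valring by <:].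

Definition valring_unit : {pred valring} :=
  fun x => (val x != 0) && ((val x)^-1 \in integers).
Definition valring_inv (x : valring) : valring := insubd x (val x)^-1.

Fact valring_mulVx : {in valring_unit, left_inverse 1 valring_inv *%R}.
Proof.
move=> x /andP[x0 xV]; apply: val_inj.
by rewrite rmorphM /= val_insubd xV mulVf // rmorph1.
Qed.

Fact valring_unitPl (x y : valring) : y * x = 1 -> valring_unit x.
Proof.
move=> /(congr1 val); rewrite rmorphM rmorph1 /= => yx.
have x0 : val x != 0.
  by apply: contra_eq_neq yx => ->; rewrite mulr0 eq_sym oner_neq0.
by rewrite /valring_unit x0 /= -[_^-1]mul1r -yx mulfK // (valP y).
Qed.

Fact valring_inv_out : {in [predC valring_unit], valring_inv =1 id}.
Proof.
move=> x; rewrite inE /= unfold_in /valring_unit negb_and negbK => nu.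
apply: val_inj; rewrite val_insubd; case: ifP => // xV.
by move: nu; rewrite xV orbF => /eqP ->; rewrite invr0.
Qed.

HB.instance Definition _ := GRing.ComNzRing_hasMulInverse.Build valring
  valring_mulVx valring_unitPl valring_inv_out.

Record uniformizer := Uniformizer {
  unif :> valring;
  _ : (val unif != 0) && (v (val unif) == 1) }.

Context (pi : uniformizer).

Definition unif_ideal : {pred valring} :=
  fun x => `[< exists y : valring, x = unif pi * y >].

Lemma unif_idealE (x : valring) : (x \in unif_ideal) = vge 1 (val x).
Proof.
have /andP[p0 /eqP vp] : (val (unif pi) != 0) && (v (val (unif pi)) == 1).
  by case: pi.
apply/asboolP/idP => [[y ->]|].
  rewrite /vge rmorphM /= mulf_eq0 (negPf p0) /=.
  case: eqVneq => //= y0; rewrite dvalM // vp lerDl.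
  by have := valP y; rewrite unfold_in /vge (negPf y0).
move=> vx.
have yO : val x / val (unif pi) \in integers.
  move: vx; rewrite unfold_in /vge mulf_eq0 invr_eq0 (negPf p0) orbF.
  case: eqVneq => //= x0 vx; rewrite dvalM ?invr_eq0 // dvalV // vp.
  by rewrite subr_ge0.
exists (Valring yO); apply: val_inj.
by rewrite rmorphM /= mulrC divfK.
Qed.

Fact unif_ideal_closed : idealr_closed unif_ideal.
Proof.
split.
- by apply/asboolP; exists 0; rewrite mulr0.
- by rewrite unif_idealE /vge rmorph1 oner_eq0 dval1.
- move=> a x y /asboolP[b ->] /asboolP[c ->]; apply/asboolP.
  by exists (a * b + c); rewrite mulrDr mulrCA.
Qed.

HB.instance Definition _ := isIdealr.Build valring unif_ideal unif_ideal_closed.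

Definition residue_field : Type := {ideal_quot unif_ideal}.

HB.instance Definition _ := GRing.ComNzRing.on residue_field.
HB.instance Definition _ : EqQuotient valring (Quotient.equiv unif_ideal)
  residue_field := EqQuotient.on residue_field.
HB.instance Definition _ := @isZmodQuotient.Build valring
  (Quotient.equiv unif_ideal) 0 -%R +%R residue_field
  (lock _) (@Quotient.pi_opp _ _) (@Quotient.pi_add _ _).
HB.instance Definition _ := @isNzRingQuotient.Build valring
  (Quotient.equiv unif_ideal) 0 -%R +%R 1%R *%R residue_field
  (lock _) (@Quotient.pi_mul _ _).

Definition residue_inv (a : residue_field) : residue_field :=
  \pi_residue_field ((repr a)^-1).

Fact residue_mulVf (a : residue_field) : a != 0 -> residue_inv a * a = 1.
Proof.
rewrite -{1 3}[a]reprK -[0](rmorph0 \pi_residue_field) -Quotient.idealrBE subr0.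
rewrite unif_idealE /residue_inv; set x := repr a => x_nm.
have xU : x \is a GRing.unit.
  have := valP x; rewrite unfold_in /vge.
  move: x_nm; rewrite /vge; case: eqVneq => //= x0; rewrite -ltNge => v1 v0.
  apply/andP; split => //; rewrite unfold_in /vge dvalV // oppr_ge0.
  by rewrite -ltzD1 add0r v1 orbT.
by rewrite -rmorphM /= mulVr // rmorph1.
Qed.

Fact residue_inv0 : residue_inv 0 = 0.
Proof.
rewrite /residue_inv; set x := repr _.
have x_m : x \in unif_ideal.
  by rewrite -[x]subr0 Quotient.idealrBE reprK rmorph0.
rewrite invr_out; first by rewrite reprK.
apply/negP => xU.
suff : (1 : valring) \in unif_ideal by rewrite idealr1.
by rewrite -(mulVr xU); exact: idealMr.
Qed.

HB.instance Definition _ := GRing.ComNzRing_isField.Build residue_field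
  residue_mulVf residue_inv0.

Definition mx_lattice n (m : int) : set 'M[K]_n :=
  [set (val (unif pi)) ^ m *: map_mx val A | A in [set: 'M[valring]_n]].

Definition poly_lattice n (m : int) : set {poly_n K} :=
  [set (val (unif pi)) ^ m *: p |
    p in [set p : {poly_n K} | (p : {poly K}) \is a polyOver integers]].

End Valuation.

Arguments mx_lattice {K v} pi n m.
Arguments poly_lattice {K v} pi n m.

(* Differentiability for the sup norms on matrix entries and on polynomial
   coefficients: for every C, ||f(M + H) - f(M) - L(H)|| <= |pi|^C ||H|| as soon
   as ||H|| is small enough. *)
Definition is_differential (K : fieldType) (v : discrete_valuation K) n d
    (f : 'M[K]_n -> {poly K}) (M : 'M[K]_n)
    (L : {linear 'M[K]_n -> {poly_d K}}) : Prop :=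
  forall C : int, exists D : int, forall (N : int) (H : 'M[K]_n),
    D <= N -> (forall i j, vge v N (H i j)) ->
    forall i, vge v (N + C) (f (M + H) - f M - (L H : {poly K}))`_i.

Definition has_cyclic_vector (k : fieldType) n (A : 'M[k]_n) : Prop :=
  exists c : 'cV[k]_n,
    basis_of {:'cV[k]_n} (mkseq (fun j => iter j (mulmx A) c) n).

(* Main.v *)
Require Import Defs.
From mathcomp Require Import all_boot all_order all_algebra.
From mathcomp Require Import perm.
From mathcomp Require Import boolp classical_sets.
From mathcomp Require Import ring.

Set Implicit Arguments.
Unset Strict Implicit.
Unset Printing Implicit Defensive.

Import Order.TTheory GRing.Theory Num.Theory.
Local Open Scope ring_scope.
Local Open Scope quotient_scope.
Local Open Scope classical_set_scope.

(** Let O be the valuation ring of K and k its residue field.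

    Why the theorem is true.  Let chi be the characteristic polynomial of M and
    write delta(H) = tr(Adj(X - M) H).  Expanding a determinant to first order
    shows that the differential of the characteristic polynomial at M is
    - delta ([char_poly_first_order], [char_diff_is_differential]).  Since
    delta is defined over O, it maps matrices over O to polynomials of degree
    < n over O, and rescaling by the m-th power of the uniformizer, the
    inclusion of lattices is strict if and only if delta, as a map from M_n(O)
    to polynomials of degree < n over O, is not surjective
    ([precision_lattice_full]).  It remains to see that delta is surjective if
    and only if the reduction of M has a cyclic vector.  For n = 0 both hold
    trivially; let n > 0.

    If the reduction has a cyclic vector, lift it to a vector c over O.  The
    determinant of (c, M c, ..., M^(n-1) c) is nonzero in k, hence is a unit of
    O.  Let r be the row vector with r M^j c = 0 for j < n - 1 and
    r M^(n-1) c = 1.  Multiplying (X - M) by its adjugate gives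
      delta(M^(j+1) c r) = X delta(M^j c r) - (r M^j c) chi,
    so that delta(M^j c r) = X^j delta(c r) for j < n.  All these polynomials
    have degree < n, which forces delta(c r) to be constant; taking j = n - 1 in
    the recursion then forces this constant to be 1.  So every X^j with j < n is
    a value of delta ([char_diff_surj]).

    If delta is surjective, then it takes the value 1, and so does its
    analogue delta_k for the reduction A of M over k.  Let p be the minimal
    polynomial of A.  Since p(A) = 0, the scalar matrix p factors as Q (X - A),
    so p Adj(X - A) = chi_A Q, and chi_A divides p delta_k(H) for every H,
    hence divides p ([char_poly_dvd_mxminpoly]).  On the other hand, over any
    field there is a vector w whose order (the generator of the ideal of all q
    with q(A) w = 0) is the minimal polynomial ([mxminpoly_order]).  As its
    degree is n, the vectors w, A w, ..., A^(n-1) w are independent. *)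

(** * First-order expansion of the characteristic polynomial *)

Lemma prod_first_order (R : comNzRingType) (I : finType) (t : R)
    (a b : I -> R) :
  exists r, \prod_i (a i + t * b i) =
    \prod_i a i + t * (\sum_i b i * \prod_(j | j != i) a j) + t ^+ 2 * r.
Proof.
suff H : forall s : seq I, uniq s -> exists r,
    \prod_(i <- s) (a i + t * b i) = \prod_(i <- s) a i
      + t * (\sum_(i <- s) b i * \prod_(j <- s | j != i) a j) + t ^+ 2 * r.
  exact: H (index_enum_uniq I).
elim=> [_|x s IHs /= /andP[xs us]].
  by exists 0; rewrite !big_nil !mulr0 !addr0.
have [r Er] := IHs us.
exists (b x * (\sum_(i <- s) b i * \prod_(j <- s | j != i) a j)
        + (a x + t * b x) * r).
rewrite !big_cons Er eqxx /=.
have -> : \prod_(j <- s | j != x) a j = \prod_(j <- s) a j.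
  rewrite big_seq_cond [RHS]big_seq; apply: eq_bigl => j.
  by case: eqVneq => [->|]; rewrite ?andbT // (negPf xs).
have -> : \sum_(i <- s) b i * \prod_(j <- x :: s | j != i) a j
    = a x * \sum_(i <- s) b i * \prod_(j <- s | j != i) a j.
  rewrite mulr_sumr; apply: eq_big_seq => i si; rewrite big_cons.
  have -> : x != i by apply: contraNneq xs => ->.
  by rewrite mulrCA.
set P := \prod_(j <- s) _; set S := \sum_(j <- s) _.
ring.
Qed.

(** The coefficient of t is the sum over i of the determinants obtained from A
    by replacing its i-th row with that of B; expanding each of them along this
    row turns the sum into the trace of Adj(A) B. *)
Lemma det_first_order (R : comNzRingType) n (t : R) (A B : 'M[R]_n) :
  exists r, \det (A + t *: B) = \det A + t * \tr (\adj A *m B) + t ^+ 2 * r.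
Proof.
pose P (s : {perm 'I_n}) r := \prod_i (A i (s i) + t * B i (s i)) =
  \prod_i A i (s i)
  + t * (\sum_i B i (s i) * \prod_(j | j != i) A j (s j)) + t ^+ 2 * r.
have /choice[r Er] : forall s, exists r, P s r.
  by move=> s; exact: prod_first_order.
exists (\sum_(s : {perm 'I_n}) (-1) ^+ s * r s).
have -> : \tr (\adj A *m B) =
    \sum_(s : {perm 'I_n})
      (-1) ^+ s * \sum_i B i (s i) * \prod_(j | j != i) A j (s j).
  transitivity (\sum_i \det (\matrix_(k, l) if k == i then B k l else A k l)).
    rewrite mxtrace_mulC; apply: eq_bigr => i _.
    rewrite (expand_det_row _ i) mxE; apply: eq_bigr => j _.
    rewrite !mxE eqxx; congr (_ * (_ * \det _)).
    by apply/matrixP => k l; rewrite !mxE eq_sym (negPf (neq_lift _ _)).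
  rewrite exchange_big; apply: eq_bigr => s _.
  rewrite -mulr_sumr; congr (_ * _); apply: eq_bigr => i _.
  rewrite (bigD1 i) //= mxE eqxx; congr (_ * _).
  by apply: eq_bigr => j /negPf ji; rewrite mxE ji.
rewrite !mulr_sumr -!big_split; apply: eq_bigr => s _ /=.
rewrite (eq_bigr (fun i => A i (s i) + t * B i (s i))); last first.
  by move=> i _; rewrite !mxE.
by rewrite Er !mulrDr !(mulrCA t) !(mulrCA (t ^+ 2)).
Qed.

(** The differential at A of the characteristic polynomial, up to sign. *)
Definition char_diff (R : comNzRingType) n (A H : 'M[R]_n) : {poly R} :=
  \tr (\adj (char_poly_mx A) *m map_mx polyC H).

Lemma char_poly_first_order (R : comNzRingType) n (t : R) (A H : 'M[R]_n) :
  exists r, char_poly (A + t *: H)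
    = char_poly A - t *: char_diff A H + t ^+ 2 *: r.
Proof.
have [r Er] := det_first_order t%:P (char_poly_mx A) (- map_mx polyC H).
exists r; rewrite -!mul_polyC rmorphXn /= -mulrN -raddfN /= -mulmxN -Er.
congr (\det _).
by rewrite /char_poly_mx map_mxD map_mxZ opprD addrA scalerN.
Qed.

Lemma map_char_diff (R S : comNzRingType) (f : {rmorphism R -> S}) n
    (A H : 'M[R]_n) :
  map_poly f (char_diff A H) = char_diff (map_mx f A) (map_mx f H).
Proof.
rewrite /char_diff -map_char_poly_mx -map_mx_adj -trace_map_mx map_mxM.
congr (\tr (_ *m _)); apply/matrixP => i j.
by rewrite !mxE /= map_polyC.
Qed.

(** A cofactor of X - A is a sum of products of n - 1 entries, each of degree
    at most 1. *)
Lemma size_adj_char_poly_mx (R : comNzRingType) n (A : 'M[R]_n) i j :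
  (size (\adj (char_poly_mx A) i j) <= n)%N.
Proof.
case: n A i j => [|n] A i j; first by case: i.
rewrite mxE /cofactor size_Msign /determinant.
apply: leq_trans (size_sum _ _ _) _; apply/bigmax_leqP=> s _.
rewrite size_Msign.
rewrite -[X in (_ <= X.+1)%N]card_ord -sum1_card.
apply: (big_ind2 (fun (p : {poly R}) m => size p <= m.+1)%N).
- by rewrite size_poly1.
- move=> p mp q mq IHp IHq; apply: leq_trans (size_polyMleq _ _) _.
  by rewrite -subn1 -addnS leq_subLR addnA leq_add.
move=> k _; rewrite !mxE; case: eqP => _; rewrite ?mulr1n ?polyseqXsubC //.
by rewrite mulr0n sub0r size_polyN size_polyC; case: (_ != 0).
Qed.

Lemma size_char_diff (R : comNzRingType) n (A H : 'M[R]_n) :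
  (size (char_diff A H) <= n)%N.
Proof.
apply: leq_trans (size_sum _ _ _) _; apply/bigmax_leqP=> i _.
rewrite mxE; apply: leq_trans (size_sum _ _ _) _; apply/bigmax_leqP=> j _.
rewrite [map_mx _ _ _ _]mxE mulrC mul_polyC (leq_trans (size_scale_leq _ _)) //.
exact: size_adj_char_poly_mx.
Qed.

Lemma map_char_poly_first_order (R S : comNzRingType) (f : {rmorphism R -> S})
    n (t : R) (A H : 'M[R]_n) :
  exists r, char_poly (map_mx f A + f t *: map_mx f H) - char_poly (map_mx f A)
    = f t *: (f t *: map_poly f r - map_poly f (char_diff A H)).
Proof.
have [r Er] := char_poly_first_order t A H; exists r.
rewrite -map_mxZ -map_mxD -!map_char_poly Er.
rewrite rmorphD rmorphB /= !map_polyZ rmorphXn scalerBr scalerA -expr2.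
by rewrite addrC -addrA addKr addrC.
Qed.

(** * Cyclic vectors and the surjectivity of the differential *)

Definition krylov (R : pzSemiRingType) n (A : 'M[R]_n) (c : 'cV[R]_n) :
    'M[R]_n :=
  \matrix_(i, j) iter j (mulmx A) c i 0.

Lemma mulmx_krylov (R : comPzRingType) n (A : 'M[R]_n) (c z : 'cV[R]_n) :
  krylov A c *m z = \sum_j z j 0 *: iter j (mulmx A) c.
Proof.
apply/colP => i; rewrite mxE summxE; apply: eq_bigr => j _.
by rewrite !mxE mulrC.
Qed.

Lemma map_krylov (R S : pzSemiRingType) (f : {rmorphism R -> S}) n
    (A : 'M[R]_n) (c : 'cV[R]_n) :
  map_mx f (krylov A c) = krylov (map_mx f A) (map_mx f c).
Proof.
apply/matrixP => i j; rewrite !mxE.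
suff -> : iter j (mulmx (map_mx f A)) (map_mx f c)
    = map_mx f (iter j (mulmx A) c) by rewrite mxE.
by elim: (val j) => //= k ->; rewrite map_mxM.
Qed.

Lemma krylov_kernel (k : fieldType) n (A : 'M[k]_n) (c : 'cV[k]_n) :
  krylov A c \notin unitmx ->
  exists2 z : 'cV[k]_n, z != 0 & krylov A c *m z = 0.
Proof.
rewrite unitmxE unitfE negbK -det_tr => /det0P[z z0 zC].
exists z^T; first by rewrite -(inj_eq trmx_inj) trmxK trmx0.
by apply: trmx_inj; rewrite trmx_mul trmxK zC trmx0.
Qed.

Lemma cyclic_vectorP (k : fieldType) n (A : 'M[k]_n) :
  has_cyclic_vector A <-> exists c, krylov A c \in unitmx.
Proof.
pose X (c : 'cV[k]_n) := map_tuple (fun j => iter j (mulmx A) c) (iota_tuple n 0).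
split=> -[c cP]; exists c.
  have /freeP fr : free (X c).
    exact: basis_free cP.
  apply/negPn/negP => /krylov_kernel[z /eqP z_neq0]; rewrite mulmx_krylov => z0.
  apply: z_neq0; apply/colP => i; rewrite mxE; apply: (fr (fun i => z i 0)).
  by rewrite -[RHS]z0; apply: eq_bigr => j _; rewrite nth_mkseq.
rewrite basisEfree subvf size_mkseq dimvf /dim /= muln1 leqnn !andbT.
apply/(@freeP _ _ _ (X c)) => a a0 i.
have : krylov A c *m (\col_j a j) = 0.
  rewrite mulmx_krylov -[RHS]a0; apply: eq_bigr => j _.
  by rewrite nth_mkseq // mxE.
move=> /(canRL (mulKmx cP)); rewrite mulmx0 => /colP/(_ i).
by rewrite !mxE.
Qed.

Lemma char_diff_col_row (R : comNzRingType) n (A : 'M[R]_n)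
    (x : 'cV[R]_n) (r : 'rV[R]_n) :
  char_diff A (x *m r)
  = (map_mx polyC r *m \adj (char_poly_mx A) *m map_mx polyC x) 0 0.
Proof. by rewrite /char_diff map_mxM mulmxA mxtrace_mulC mulmxA trace_mx11. Qed.

(** Here A = X - (X - A), and Adj(X - A) (X - A) is the scalar matrix chi_A. *)
Lemma char_diff_mul_col_row (R : comNzRingType) n (A : 'M[R]_n)
    (x : 'cV[R]_n) (r : 'rV[R]_n) :
  char_diff A (A *m x *m r)
  = 'X * char_diff A (x *m r) - (r *m x) 0 0 *: char_poly A.
Proof.
rewrite !char_diff_col_row map_mxM.
have -> : map_mx polyC A = 'X%:M - char_poly_mx A.
  by rewrite /char_poly_mx opprB addrC subrK.
rewrite mulmxBl mulmxBr mul_scalar_mx -scalemxAr !mulmxA.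
rewrite -(mulmxA _ _ (char_poly_mx A)) mul_adj_mx mul_mx_scalar -scalemxAl.
rewrite -map_mxM !mxE; congr (_ - _).
by rewrite mulrC -mul_polyC.
Qed.

(** With r the last row of the inverse of (c, A c, ..., A^(n-1) c), the matrices
    A^j c r are mapped to X^j: the recursion of
    [char_diff_mul_col_row] multiplies by X as long as r A^j c = 0, and
    comparing degrees shows that the value at j = 0 is 1. *)
Lemma char_diff_surj (R : comUnitRingType) n (A : 'M[R]_n) (c : 'cV[R]_n) :
  krylov A c \in unitmx ->
  forall p : {poly R}, (size p <= n)%N -> exists H, char_diff A H = p.
Proof.
case: n A c => [|n] A c cU p szp.
  exists 0; rewrite /char_diff /mxtrace big_ord0.
  by apply/esym/eqP; rewrite -size_poly_leq0.
pose r : 'rV[R]_n.+1 := row ord_max (invmx (krylov A c)).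
pose e j := char_diff A (iter j (mulmx A) c *m r).
have rA (j : 'I_n.+1) : (r *m iter j (mulmx A) c) 0 0 = (j == ord_max)%:R.
  transitivity ((invmx (krylov A c) *m krylov A c) ord_max j).
    by rewrite !mxE; apply: eq_bigr => i _; rewrite !mxE.
  by rewrite mulVmx // mxE eq_sym.
have eS j : e j.+1 = 'X * e j - (r *m iter j (mulmx A) c) 0 0 *: char_poly A.
  exact: char_diff_mul_col_row.
have eX j : (j <= n)%N -> e j = 'X^j * e 0%N.
  elim: j => [|j IHj] jn; first by rewrite mul1r.
  rewrite eS (rA (Ordinal (ltnW jn : (j < n.+1)%N))) -val_eqE /= ltn_eqF //.
  by rewrite scale0r subr0 IHj ?(ltnW jn) // exprS mulrA.
have sz_e j : (size (e j) <= n.+1)%N by exact: size_char_diff.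
(* X^n e_0 = e_n has size at most n + 1, so e_0 has size at most 1. *)
have e0C : e 0%N = ((e 0%N)`_0)%:P.
  apply: size1_polyC; apply/leq_sizeP => i i0.
  have := nth_default 0 (leq_trans (sz_e n) (leq_addr i.-1 n.+1)).
  by rewrite eX // coefXnM addSnnS prednK // ltnNge leq_addr /= addKn.
(* The coefficient of X^(n+1) in e_(n+1) = X^(n+1) e_0 - chi vanishes. *)
have e01 : e 0%N = 1.
  have := nth_default 0 (sz_e n.+1).
  rewrite eS (rA ord_max) eqxx scale1r eX // mulrA -exprS coefB coefXnM ltnn.
  have := char_poly_monic A; rewrite monicE lead_coefE size_char_poly /=.
  move=> /eqP->.
  by rewrite subnn e0C coefC /= => /eqP; rewrite subr_eq0 => /eqP->.
exists (\sum_(j < n.+1) p`_j *: (iter j (mulmx A) c *m r)).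
transitivity (\sum_(j < n.+1) p`_j *: e j).
  rewrite /char_diff raddf_sum mulmx_sumr raddf_sum; apply: eq_bigr => j _ /=.
  by rewrite map_mxZ -scalemxAr mxtraceZ mul_polyC.
rewrite [RHS](_ : p = \poly_(j < n.+1) p`_j); last first.
  apply/polyP => i; rewrite coef_poly; case: ltnP => // ni.
  by rewrite nth_default ?(leq_trans szp).
rewrite poly_def; apply: eq_bigr => j _.
by rewrite (eX j (ltn_ord j)) e01 mulr1.
Qed.

(** The minimal polynomial p kills A, so the scalar matrix p is right divisible
    by X - A; multiplying by the adjugate, chi_A divides every entry of
    p Adj(X - A), hence p tr(Adj(X - A) H) = p. *)
Lemma char_poly_dvd_mxminpoly (k : fieldType) n (A H : 'M[k]_n.+1) :
  char_diff A H = 1 -> char_poly A %| mxminpoly A.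
Proof.
move=> H1; have [phi [[psi psiK phiK] phiZ phiC _]] := mx_poly_ring_isom k n.
set p := mxminpoly A.
(* Viewing matrices of polynomials as polynomials with matrix coefficients,
   the factor theorem applies to the root A. *)
have [Q pE] : exists Q, p%:M = Q *m char_poly_mx A.
  have /factor_theorem[q pE] : root (map_poly scalar_mx p) A.
    exact/rootP/mx_root_minpoly.
  exists (psi q); apply: (can_inj psiK).
  by rewrite phiZ [LHS]pE rmorphM /= phiK rmorphB phiC phiZ map_polyX.
have pA : p *: \adj (char_poly_mx A) = char_poly A *: Q.
  by rewrite -mul_scalar_mx pE -mulmxA mul_mx_adj mul_mx_scalar.
rewrite -[p]mulr1 -H1 /char_diff -mxtraceZ scalemxAl pA -scalemxAl mxtraceZ.
exact: dvdp_mulr.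
Qed.

(** * Vectors whose order is the minimal polynomial *)

(** Separates the part of f supported at the prime factors of g from the rest,
    without any factorization into primes: divide f by its greatest common
    divisor with g until the quotient is coprime to g. *)
Lemma coprime_splitting (k : fieldType) (f g : {poly k}) :
  f != 0 -> exists a b, [/\ f = a * b, coprimep a g & exists N, b %| g ^+ N].
Proof.
have [m] := ubnP (size f); elim: m f => // m IHm f; rewrite ltnS => fm f0.
have [fg|ncfg] := boolP (coprimep f g).
  by exists f, 1; rewrite mulr1; split=> //; exists 0%N; rewrite dvd1p.
have [d0 d1] : gcdp f g != 0 /\ (1 < size (gcdp f g))%N.
  have d0 : gcdp f g != 0 by rewrite gcdp_eq0 negb_and f0.
  by split=> //; rewrite ltn_neqAle eq_sym ncfg lt0n size_poly_eq0.
have fE := divpK (dvdp_gcdl f g).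
set q := f %/ gcdp f g in fE.
have q0 : q != 0 by apply: contraNneq f0 => q0; rewrite -fE q0 mul0r.
have [|//|a [b [qE ag [N bN]]]] := IHm q.
  apply: leq_trans fm; rewrite -fE size_mul //.
  case: (size (gcdp f g)) d1 => [|[|e]] // _.
  by rewrite addnS addnS ltnS leq_addr.
exists a, (b * gcdp f g); split=> //; first by rewrite mulrA -qE fE.
by exists N.+1; rewrite exprSr dvdp_mul // dvdp_gcdr.
Qed.

Section VectorOrder.
Context (k : fieldType) (n : nat) (A : 'M[k]_n.+1).
Implicit Types (u v w : 'cV[k]_n.+1) (f g p q : {poly k}).

Lemma horner_mx_mulmx p q u :
  horner_mx A (p * q) *m u = horner_mx A p *m (horner_mx A q *m u).
Proof. by rewrite rmorphM mulmxA. Qed.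

(** f generates the annihilator of u for the action of k[X] through A. *)
Definition is_order u f := forall p, (horner_mx A p *m u == 0) = (f %| p).

Lemma order_exists u : exists f, is_order u f.
Proof.
pose P m := `[< exists q, [/\ q != 0, horner_mx A q *m u = 0 & size q = m] >].
have exP : exists m, P m.
  exists (size (mxminpoly A)); apply/asboolP; exists (mxminpoly A); split=> //.
    by rewrite monic_neq0 ?mxminpoly_monic.
  by rewrite mx_root_minpoly mul0mx.
case: (ex_minnP exP) => m /asboolP[f [f0 fu szf]] minf.
exists f => p; apply/eqP/idP => [pu|/dvdpP[q ->]]; last first.
  by rewrite horner_mx_mulmx fu mulmx0.
apply: contraTT isT => fp.
suff : (m <= size (p %% f)%R)%N by rewrite leqNgt -szf ltn_modp f0.
apply: minf; apply/asboolP; exists (p %% f); split=> //.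
move: pu; rewrite {1}(divp_eq p f) rmorphD /= mulmxDl horner_mx_mulmx fu.
by rewrite mulmx0 add0r.
Qed.

Lemma order_dvd_mxminpoly u f : is_order u f -> f %| mxminpoly A.
Proof. by move=> <-; rewrite mx_root_minpoly mul0mx. Qed.

Lemma order_neq0 u f : is_order u f -> f != 0.
Proof.
move=> /order_dvd_mxminpoly fA; apply: contraTneq fA => ->; rewrite dvd0p.
by rewrite monic_neq0 ?mxminpoly_monic.
Qed.

Lemma order_mul u f g : g != 0 ->
  is_order u (f * g) -> is_order (horner_mx A g *m u) f.
Proof.
by move=> g0 ufg p; rewrite -horner_mx_mulmx ufg dvdp_mul2r.
Qed.

(** If p kills u + v, then p(A) u = - p(A) v is killed by both f and g, which
    are coprime, so it is 0. *)
Lemma order_add u v f g : coprimep f g ->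
  is_order u f -> is_order v g -> is_order (u + v) (f * g).
Proof.
move=> fg uf vg p; rewrite Gauss_dvdp // -uf -vg mulmxDr.
apply/eqP/andP => [uv0|[/eqP-> /eqP->]]; last by rewrite addr0.
split.
  rewrite uf -(Gauss_dvdpr _ fg) -uf horner_mx_mulmx.
  move/eqP: uv0; rewrite addr_eq0 => /eqP->.
  rewrite mulmxN -horner_mx_mulmx oppr_eq0 vg.
  exact: dvdp_mulr.
have gf : coprimep g f by rewrite coprimep_sym.
rewrite vg -(Gauss_dvdpr _ gf) -vg horner_mx_mulmx.
move/eqP: uv0; rewrite addrC addr_eq0 => /eqP->.
rewrite mulmxN -horner_mx_mulmx oppr_eq0 uf.
exact: dvdp_mulr.
Qed.

(** The least common multiple of f and g is the order of some vector.  To reach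
    it with [order_add], one needs coprime divisors of f and g with this
    product: writing f = f' h and g = g' h with h the gcd, split f = a b with a
    coprime to g' and b dividing a power of g'; then b divides h, because it is
    coprime to f', and the divisors are a and g' b. *)
Lemma larger_order u v f g : is_order u f -> is_order v g -> ~~ (g %| f) ->
  exists w h, is_order w h /\ (size f < size h)%N.
Proof.
move=> uf vg ngf.
have [f0 g0] := (order_neq0 uf, order_neq0 vg).
set h := gcdp f g.
have h0 : h != 0 by rewrite gcdp_eq0 negb_and f0.
have fE : f %/ h * h = f := divpK (dvdp_gcdl f g).
have gE : g %/ h * h = g := divpK (dvdp_gcdr f g).
have f'g' : coprimep (f %/ h) (g %/ h) by rewrite coprimep_div_gcd ?f0.
set f' := f %/ h in fE f'g'; set g' := g %/ h in gE f'g'.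
have [a [b [fab ag' [N bN]]]] := coprime_splitting g' f0.
have bf' : coprimep b f'.
  by rewrite (coprimep_dvdr bN) // coprimep_expl // coprimep_sym.
have /dvdpP[q hqb] : b %| h.
  by rewrite -(Gauss_dvdpr h bf') fE fab dvdp_mull.
have b0 : b != 0 by apply: contraNneq f0 => b0; rewrite fab b0 mulr0.
have q0 : q != 0 by apply: contraNneq h0 => q0; rewrite hqb q0 mul0r.
exists (horner_mx A b *m u + horner_mx A q *m v), (a * (g' * b)); split.
  apply: order_add.
  - by rewrite coprimepMr ag' (coprimep_dvdl bN) // coprimep_expr.
  - by apply: order_mul => //; rewrite -fab.
  - by apply: order_mul => //; rewrite -mulrA [b * q]mulrC -hqb gE.
have g'0 : g' != 0 by apply: contraNneq g0 => g'0; rewrite -gE g'0 mul0r.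
have g'1 : (1 < size g')%N.
  rewrite ltnNge; apply: contra ngf => /size1_polyC g'C.
  rewrite -gE g'C mul_polyC dvdpZl ?dvdp_gcdl //.
  by apply: contraNneq g'0 => c0; rewrite g'C c0 polyC0.
rewrite mulrCA -fab size_mul //.
by case: (size g') g'1 => [|[|e]] // _; rewrite addSn addSn ltnS leq_addl.
Qed.

(** A vector whose order f has maximal degree: by [larger_order] the order of
    every vector divides f, so f(A) = 0. *)
Lemma mxminpoly_order : exists w, is_order w (mxminpoly A).
Proof.
pose P m := `[< exists w f, is_order w f /\ size f = m >].
have exP : exists m, P m.
  have [f uf] := order_exists 0.
  by exists (size f); apply/asboolP; exists 0, f.
have ubP m : P m -> (m <= size (mxminpoly A))%N.
  case/asboolP => w [f [wf <-]]; apply: dvdp_leq (order_dvd_mxminpoly wf).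
  by rewrite monic_neq0 ?mxminpoly_monic.
case: (ex_maxnP exP ubP) => m /asboolP[w [f [wf szf]]] maxf.
exists w => p; rewrite wf.
suff fA : mxminpoly A %| f.
  by apply/idP/idP; apply: dvdp_trans => //; apply: order_dvd_mxminpoly wf.
apply: mxminpoly_min; apply/matrixP => i j.
have [g vg] := order_exists (delta_mx j 0).
have gf : g %| f.
  apply: contraT => /(larger_order wf vg)[v [h [vh]]].
  by rewrite ltnNge szf maxf //; apply/asboolP; exists v, h.
by move: gf; rewrite -vg -colE => /eqP/colP/(_ i); rewrite !mxE.
Qed.

(** A linear relation between w, A w, ..., A^n w is a polynomial of degree at
    most n killing w, but the order of w has degree n + 1. *)
Lemma cyclic_of_mxminpoly :
  char_poly A %| mxminpoly A -> exists c, krylov A c \in unitmx.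
Proof.
move=> chiA; have [w wA] := mxminpoly_order; exists w.
apply: contraT => /krylov_kernel[z z0 wz].
pose p := rVpoly z^T.
have pw : mxminpoly A %| p.
  rewrite -wA -wz mulmx_krylov /p /rVpoly poly_def raddf_sum mulmx_suml.
  apply/eqP/eq_bigr => i _; rewrite insubT /= => [|j_lt]; first exact: ltn_ord.
  rewrite mxE horner_mxZ -scalemxAl rmorphXn /= horner_mx_X.
  congr (z _ _ *: _); first exact: val_inj.
  by elim: (val i) => [|j IHj]; rewrite ?mul1mx //= exprS -mulmxA IHj.
have p0 : p != 0.
  apply: contra z0 => /eqP p0; rewrite -(inj_eq trmx_inj) trmx0.
  by rewrite -[z^T]rVpolyK -/p p0 raddf0.
have := dvdp_leq p0 (dvdp_trans chiA pw).
by rewrite size_char_poly ltnNge size_poly.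
Qed.

End VectorOrder.

Lemma char_diff_eq1P (k : fieldType) n (A : 'M[k]_n.+1) :
  (exists c, krylov A c \in unitmx) <-> exists H, char_diff A H = 1.
Proof.
split=> [[c cU]|[H H1]].
  by apply: char_diff_surj cU _ _; rewrite size_poly1.
exact/cyclic_of_mxminpoly/char_poly_dvd_mxminpoly/H1.
Qed.

(** * Lattices over the valuation ring *)

Section Valuation.
Context (K : fieldType) (v : discrete_valuation K) (pi : uniformizer v).
Implicit Types (x y : K) (N : int).
Local Notation varpi := (val (unif pi)).
Local Notation OtoK := (val : valring v -> K).

Lemma unif_neq0 : varpi != 0.
Proof. by case: pi => p /= /andP[]. Qed.

Lemma dval_unifX (z : int) : v (varpi ^ z) = z.
Proof.
have natX (j : nat) : v (varpi ^+ j) = j.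
  elim: j => [|j IHj]; first by rewrite expr0 dval1.
  rewrite exprS dvalM ?expf_neq0 ?unif_neq0 // IHj.
  have -> : v varpi = 1 by case: pi => p /= /andP[_ /eqP].
  by rewrite -intS.
case: z => j; first exact: natX.
by rewrite NegzE -exprnN dvalV ?expf_neq0 ?unif_neq0 // natX.
Qed.

Lemma vge_unifX (z : int) N x : vge v (N + z) (varpi ^ z * x) = vge v N x.
Proof.
rewrite /vge mulf_eq0 expfz_eq0 (negPf unif_neq0) andbF /=.
have [//|x0] := eqVneq x 0.
by rewrite dvalM ?expfz_neq0 ?unif_neq0 // dval_unifX addrC lerD2l.
Qed.

Lemma vge_le N N' x : N <= N' -> vge v N' x -> vge v N x.
Proof. by move=> NN'; rewrite /vge; case: eqVneq => //= _; exact: le_trans. Qed.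

Lemma vge_eq0 x : (forall N, vge v N x) -> x = 0.
Proof.
move=> /(_ (v x + 1)); rewrite /vge; case: eqVneq => //= _.
by rewrite gerDl ler10.
Qed.

Lemma residue_neq0_unit (a : valring v) :
  \pi_(residue_field pi) a != 0 -> a \is a GRing.unit.
Proof.
rewrite -(rmorph0 \pi_(residue_field pi)) -Quotient.idealrBE subr0 unif_idealE.
have := valP a; rewrite unfold_in /vge; case: eqVneq => //= a0 v0.
rewrite -ltNge => v1; apply/andP; split=> //.
by rewrite unfold_in /vge dvalV // oppr_ge0 -ltzD1 add0r v1 orbT.
Qed.

(** A differential is unique.  For t the N-th power of the uniformizer, the
    first-order expansion at t H makes the error t (t r - (L H + delta H)), with
    r integral, while differentiability bounds its valuation below by N + C; so
    the coefficients of L H + delta H have valuation at least C, for every C. *)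
Lemma char_diff_is_differential n (M : 'M[valring v]_n)
    (L : {linear 'M[K]_n -> {poly_n K}}) :
  is_differential v (@char_poly K n) (map_mx OtoK M) L ->
  forall H, L (map_mx OtoK H) = - map_poly OtoK (char_diff M H) :> {poly K}.
Proof.
move=> LP H; apply/eqP; rewrite -addr_eq0; apply/eqP/polyP => i.
rewrite coef0; apply: vge_eq0 => C.
have [D LD] := LP C; pose N := (absz D + absz C)%N.
have [r Er] := map_char_poly_first_order OtoK (unif pi ^+ N) M H.
have DN : D <= N by rewrite PoszD (le_trans (ler_norm D)) // lerDl.
have CN : C <= N by rewrite PoszD (le_trans (ler_norm C)) // lerDr.
have XN (a : valring v) : vge v N (varpi ^ N * val a).
  by rewrite -[N%:Z]add0r vge_unifX; exact: (valP a).
have {LD} := LD N (varpi ^ N *: map_mx OtoK H) DN.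
move=> /(_ (fun i j => _) i); set G := (X in vge v _ X) => LD.
have GE : G = varpi ^ N * (varpi ^ N * val r`_i
    - ((L (map_mx OtoK H) : {poly K}) + map_poly OtoK (char_diff M H))`_i).
  rewrite rmorphXn in Er; rewrite /G Er linearZ -scalerBr coefZ.
  congr (_ * _).
  rewrite !coefB coefZ coef_map coefD.
  by rewrite opprD addrA addrAC.
rewrite GE [N%:Z + _]addrC vge_unifX in LD.
rewrite -[X in vge v C X](subKr (varpi ^ N * val r`_i)) vgeB //.
  exact: vge_le (XN _).
by apply: LD => k l; rewrite !mxE; exact: XN.
Qed.

(** The image of the lattice lies in the lattice of polynomials because delta
    preserves integrality; equality of the two does not depend on m, by
    rescaling. *)
Lemma precision_lattice_full n (M : 'M[valring v]_n) (m : int)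
    (L : {linear 'M[K]_n -> {poly_n K}}) :
  is_differential v (@char_poly K n) (map_mx OtoK M) L ->
  (L @` mx_lattice pi n m `<` poly_lattice pi n m) <->
  ~ (forall p : {poly valring v}, (size p <= n)%N ->
       exists H, char_diff M H = p).
Proof.
move=> LP; have LE := char_diff_is_differential LP.
have sub : L @` mx_lattice pi n m `<=` poly_lattice pi n m.
  move=> _ [_ [H _ <-] <-]; exists (L (map_mx OtoK H)); last by rewrite linearZ.
  apply/polyOverP => i.
  by rewrite LE coefN (coef_map OtoK) rpredN; exact: valP.
suff full : poly_lattice pi n m `<=` L @` mx_lattice pi n m <->
    forall p : {poly valring v}, (size p <= n)%N -> exists H, char_diff M H = p.
  by rewrite /proper -full; split=> [[]|].
split=> [latL p szp|surj _ [p pO <-]].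
  have szvp : (size (map_poly OtoK p) <= n)%N.
    exact: leq_trans (size_poly _ _) szp.
  have [] := latL (varpi ^ m *: npolyp n (map_poly OtoK p)).
    exists (npolyp n (map_poly OtoK p)) => //=.
    apply/polyOverP => i; rewrite npolypK // (coef_map OtoK); exact: valP.
  move=> _ [H _ <-]; rewrite linearZ => /(scalerI (expfz_neq0 m unif_neq0)).
  move=> /(congr1 val) /=; rewrite LE npolypK // => HE.
  exists (- H); apply: (map_inj_poly val_inj (rmorph0 OtoK)).
  by rewrite -HE /char_diff map_mxN mulmxN !raddfN.
pose q := \poly_(i < n) insubd (0 : valring v) (p : {poly K})`_i.
have qE : map_poly OtoK q = p.
  apply/polyP => i; rewrite (coef_map OtoK) coef_poly; case: ltnP => ni.
    exact/insubdK/(polyOverP pO).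
  by rewrite nth_default ?raddf0 // (leq_trans (size_npoly p)).
have [|H HE] := surj (- q); first by rewrite size_polyN size_poly.
exists (varpi ^ m *: map_mx OtoK H); first by exists H.
rewrite linearZ; congr (_ *: _); apply: val_inj; rewrite /= LE HE.
by rewrite raddfN opprK.
Qed.

(** For n > 0 a single value, the constant polynomial 1, already detects a
    cyclic vector of the reduction; conversely a cyclic vector gives
    surjectivity directly over the valuation ring, since a matrix invertible
    modulo the uniformizer is invertible. *)
Lemma char_diff_surj_residue n (M : 'M[valring v]_n) :
  (forall p : {poly valring v}, (size p <= n)%N -> exists H, char_diff M H = p)
  <-> has_cyclic_vector (map_mx \pi_(residue_field pi) M).
Proof.
split=> [surj|/cyclic_vectorP[c cU] p szp].
  apply/cyclic_vectorP; case: n M surj => [|n] M surj.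
    by exists 0; rewrite unitmxE det_mx00 unitr1.
  have [|H H1] := surj 1; first by rewrite size_poly1.
  apply/char_diff_eq1P; exists (map_mx \pi_(residue_field pi) H).
  by rewrite -map_char_diff H1 rmorph1.
pose c' := \col_i repr (c i 0).
have cE : map_mx \pi_(residue_field pi) c' = c.
  by apply/colP => i; rewrite !mxE reprK.
apply: (@char_diff_surj _ _ M c') => //.
rewrite unitmxE; apply: residue_neq0_unit.
by rewrite -det_map_mx map_krylov cE -unitfE -unitmxE.
Qed.

End Valuation.

Theorem corollary2p4 (K : fieldType) (v : discrete_valuation K)
    (Kcomplete : complete v) (pi : uniformizer v) (n : nat)
    (M : 'M[valring v]_n) (MGL : M \in unitmx) (m : int)
    (dchi : {linear 'M[K]_n -> {poly_n K}})
    (dchiP : is_differential v (@char_poly K n)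
               (map_mx (val : valring v -> K) M) dchi) :
  dchi @` mx_lattice pi n m `<` poly_lattice pi n m
  <-> ~ has_cyclic_vector (map_mx \pi_(residue_field pi) M).
Proof.
rewrite (precision_lattice_full pi m dchiP) char_diff_surj_residue.
exact: iff_refl.
Qed.
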